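(* Let $n = p_1^{e_1}p_2^{e_2}\cdots p_t^{e_t}$ be a positive integer, with $p_1<p_2<\dots<p_t$ distinct primes and $e_1,\dots,e_t\ge 1$, and let $m\ge 1$ be an integer. Then the $\mathbb{Z}_n$-module of polynomial functions in $m$ variables from $\mathbb{Z}_n^m$ to $\mathbb{Z}_n$ is generated by the tensor products $u_{p_{i_1},j_1}\otimes u_{p_{i_2},j_2}\otimes\cdots\otimes u_{p_{i_m},j_m}$ together with their shifts, i.e. by the functions $$u_{p_{i_1},j_1}^{<k_1>}\otimes u_{p_{i_2},j_2}^{<k_2>}\otimes\cdots\otimes u_{p_{i_m},j_m}^{<k_m>},$$ where, for each $r=1,\dots,m$, $i_r\in\{1,\dots,t\}$, $j_r\in\{0,\dots,e_{i_r}-1\}$ and $k_r\in\{0,\dots,p_{i_r}-1\}$.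
   Context: $\mathbb{Z}_n$ is the ring of integers modulo $n$; each congruence class is represented by its least non-negative residue. A function $f:\mathbb{Z}_n^m\to\mathbb{Z}_n$ is called polynomial if there is a polynomial $P\in\mathbb{Z}_n[X_1,\dots,X_m]$ with $f(a_1,\dots,a_m)=P(a_1,\dots,a_m)$ for all $(a_1,\dots,a_m)\in\mathbb{Z}_n^m$; these functions form a $\mathbb{Z}_n$-module under pointwise operations. For $i=1,\dots,t$ and $j=0,\dots,e_i-1$, the function $u_{p_i,j}:\mathbb{Z}_n\to\mathbb{Z}_n$ is defined by $u_{p_i,j}(a)=\frac{n}{p_i^{e_i}}a^j$ if $p_i\mid a$ and $u_{p_i,j}(a)=0$ if $p_i\nmid a$, where $a$ denotes the canonical representative in $\{0,\dots,n-1\}$, divisibility is as integers, and $0^0=1$. For $v:\mathbb{Z}_n\to\mathbb{Z}_n$ and $k\in\{0,\dots,n-1\}$, the cyclic shift $v^{<k>}$ is the function $v^{<k>}(a)=v(a-k)$, $a\in\mathbb{Z}_n$ (subtraction in $\mathbb{Z}_n$). For $v_1,\dots,v_m:\mathbb{Z}_n\to\mathbb{Z}_n$, the tensor product $v_1\otimes\cdots\otimes v_m:\mathbb{Z}_n^m\to\mathbb{Z}_n$ is the function $(v_1\otimes\cdots\otimes v_m)(a_1,\dots,a_m)=v_1(a_1)\cdots v_m(a_m)$. *)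

(* Defs.v *)
From HB Require Import structures.
From mathcomp Require Import all_boot all_order all_algebra.
From mathcomp Require Import finmap monalg.

Set Implicit Arguments.
Unset Strict Implicit.
Unset Printing Implicit Defensive.

Import GRing.Theory.
Local Open Scope ring_scope.

(* The ring of integers modulo n, for n > 0, on {0, ..., n - 1}; elements     *)
(* coerce to their least non-negative residue. The library's 'Z_n is not used *)
(* because 'Z_1 has two elements; [Zmod 1] is the trivial ring. For n > 1 the *)
(* operations are those of 'Z_n. [Zmod 0] is the junk value [Zmod 1].         *)
Definition Zmod (n : nat) : predArgType := 'I_n.-1.+1.

HB.instance Definition _ n := Finite.on (Zmod n).
HB.instance Definition _ n := GRing.Zmodule.on (Zmod n).
HB.instance Definition _ n :=
  GRing.Zmodule_isComPzRing.Build (Zmod n)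
    (@Zp_mulA _) (@Zp_mulC _) (@Zp_mul1z _) (@Zp_mul_addl _).

Coercion residue n (a : Zmod n) : nat := nat_of_ord a.

(* Functions Z_n^m -> Z_n; the codomain is the regular module, so that this   *)
(* is an lmodType over Zmod n for the pointwise operations.                   *)
Notation Zfun n m := {ffun {ffun 'I_m -> Zmod n} -> (Zmod n)^o}.

(* Evaluation of a multivariate polynomial. The library's [mmap] requires a   *)
(* nontrivial ring.                                                           *)
Definition peval (R : comPzRingType) (m : nat)
    (P : {mpoly R[m]}) (a : 'I_m -> R) : R :=
  \sum_(k <- msupp P) P@_k * \prod_(i < m) a i ^+ k i.

Definition polynomial_fun (n m : nat) (f : Zfun n m) : Prop :=
  exists P : {mpoly (Zmod n)[m]}, forall a, f a = peval P a.

Definition generated (R : pzRingType) (V : lmodType R) (G : V -> Prop)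
    (v : V) : Prop :=
  exists (N : nat) (c : 'I_N -> R) (g : 'I_N -> V),
    (forall l, G (g l)) /\ v = \sum_(l < N) c l *: g l.

(* u_{q,j}, where e is the exponent of the prime q in n. *)
Definition ufun (n q e j : nat) (a : Zmod n) : Zmod n :=
  if (q %| a)%N then (n %/ q ^ e)%N%:R * a ^+ j else 0.

Definition shift (n : nat) (v : Zmod n -> Zmod n) (k : nat)
    (a : Zmod n) : Zmod n :=
  v (a - k%:R).

Definition tensor (n m : nat) (v : 'I_m -> Zmod n -> Zmod n) : Zfun n m :=
  [ffun a : {ffun 'I_m -> Zmod n} => \prod_(r < m) v r (a r)].

Definition shifted_tensor (n m t : nat) (p e : 'I_t -> nat)
    (f : Zfun n m) : Prop :=
  exists (i : 'I_m -> 'I_t) (j k : 'I_m -> nat),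
    [/\ forall r, (j r < e (i r))%N,
        forall r, (k r < p (i r))%N
      & f = tensor (fun r => shift (@ufun n (p (i r)) (e (i r)) (j r)) (k r))].

(* Main.v *)
Require Import Defs.
From mathcomp Require Import all_boot all_order all_algebra.
From mathcomp Require Import cyclic finmap monalg.

Set Implicit Arguments.
Unset Strict Implicit.
Unset Printing Implicit Defensive.

Import GRing.Theory.
Local Open Scope ring_scope.

(** Both modules are spans of tensor products of one-variable functions: the
    polynomial functions are spanned by the tensors of powers [x ^+ k]
    ([polynomial_funP]), the other module by the tensors of the shifted
    [u_{p,j}] ([shifted_tensorP]). By multilinearity, replacing each factor of
    a tensor by a combination of functions from a family [G] gives a
    combination of tensors of [G] ([tensor_generated]). So it suffices to
    compare the two families in one variable.

    Each [u_{p,j}] is a polynomial function: because of the cofactor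
    [n / p^e] only values modulo [p^e] matter, and there
    [a ^+ (phi(p^e) * e)] is the indicator of [p] not dividing [a], by Euler's
    theorem. Hence
    [u_{p,j}(a) = n / p^e * (a^j - a^(j + phi(p^e) * e))] ([ufunE]), and shifts
    of powers expand by the binomial theorem.

    Conversely, the cofactors [n / p_i^e_i] generate the unit ideal
    ([partition_of_unity]), so it is enough to obtain [n / p^e * x^k] for each
    prime [p]. On the class of [b] modulo [p], expand [x^k = (b + (x - b))^k]
    in powers of [x - b], which is divisible by [p] there: the terms are
    multiples of [u_{p,j}(x - b)], and those with [j >= e] vanish because
    [p^e] divides [(x - b)^j]. Summing over [b < p] yields [n / p^e * x^k]
    ([cofactor_power_expand], [cofactor_power_generated]). *)

(** * Spans *)

Section Span.
Variables (R : pzRingType) (V : lmodType R).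
Implicit Types (G : V -> Prop) (u v : V).

Lemma generated_gen G v : G v -> generated G v.
Proof.
move=> Gv; exists 1, (fun=> 1), (fun=> v).
by split=> //; rewrite big_ord1 scale1r.
Qed.

Lemma generated0 G : generated G 0.
Proof. by exists 0, (fun=> 0), (fun=> 0); split=> [[]|]; rewrite ?big_ord0. Qed.

Lemma generatedZ G a v : generated G v -> generated G (a *: v).
Proof.
move=> [N [c [g [Gg ->]]]]; exists N, (fun l => a * c l), g; split=> //.
by rewrite scaler_sumr; apply: eq_bigr => l _; rewrite scalerA.
Qed.

Lemma generatedD G u v : generated G u -> generated G v -> generated G (u + v).
Proof.
move=> [N [c [g [Gg ->]]]] [M [d [h [Gh ->]]]].
pose glue T (x : 'I_N -> T) (y : 'I_M -> T) (l : 'I_(N + M)) : T :=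
  match split l with inl i => x i | inr j => y j end.
exists (N + M), (glue R c d), (glue V g h); split=> [l|].
  by rewrite /glue; case: (split l).
rewrite big_split_ord /glue; congr (_ + _); apply: eq_bigr => i _.
  by rewrite -[lshift _ _]/(unsplit (inl i)) unsplitK.
by rewrite -[rshift _ _]/(unsplit (inr i)) unsplitK.
Qed.

Lemma generated_sum G I (r : seq I) (P : pred I) (F : I -> V) :
  (forall i, P i -> generated G (F i)) -> generated G (\sum_(i <- r | P i) F i).
Proof.
by move=> GF; apply: big_ind => //; [apply: generated0 | apply: generatedD].
Qed.

Lemma generated_sub G H v :
  (forall w, G w -> generated H w) -> generated G v -> generated H v.
Proof.
move=> GH [N [c [g [Gg ->]]]].
by apply: generated_sum => l _; apply: generatedZ; apply: GH.
Qed.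

End Span.

(** * Tensor products of spans *)

Notation Zfun1 n := {ffun Zmod n -> (Zmod n)^o}.

Definition tensors n m (G : Zfun1 n -> Prop) (f : Zfun n m) : Prop :=
  exists g : 'I_m -> Zfun1 n, (forall r, G (g r)) /\ f = tensor g.

Lemma eq_tensor n m (v w : 'I_m -> Zmod n -> Zmod n) :
  (forall r, v r =1 w r) -> tensor v = tensor w.
Proof.
by move=> vw; apply/ffunP=> a; rewrite !ffunE; apply: eq_bigr => r _; apply: vw.
Qed.

(** The tensor product is linear in each factor, so factors may be expanded one
    at a time. *)
Lemma tensor_generated n m (G : Zfun1 n -> Prop) (v : 'I_m -> Zfun1 n) :
  (forall r, generated G (v r)) -> generated (tensors G) (tensor v).
Proof.
(* Induction on the list [s] of the factors that remain to be expanded. *)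
suff gen (s : seq 'I_m) (w : 'I_m -> Zfun1 n) :
    (forall r, generated G (w r)) -> (forall r, r \notin s -> G (w r)) ->
    generated (tensors G) (tensor w).
  by move=> Gv; apply: (gen (enum 'I_m)) => // r; rewrite mem_enum.
elim: s w => [|r s IHs] w spanG_w G_w.
  by apply: generated_gen; exists w; split=> // r; apply: G_w.
have [N [c [g [Gg wr]]]] := spanG_w r.
pose upd l q := if q == r then g l else w q.
have ->: tensor w = \sum_(l < N) c l *: tensor (upd l) :> Zfun n m.
  apply/ffunP=> a; rewrite sum_ffunE ffunE (bigD1 r) //= wr sum_ffunE mulr_suml.
  apply: eq_bigr => l _; rewrite !ffunE.
  rewrite (bigD1 r (F := fun q => upd l q (a q))) //= {1}/upd eqxx.
  rewrite -[LHS]mulrA; congr (_ * (_ * _)); apply: eq_bigr => q /negPf q_neq_r.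
  by rewrite /upd q_neq_r.
apply: generated_sum => l _; apply/generatedZ/IHs => q; rewrite /upd.
  by case: eqP => // _; apply: generated_gen.
by move=> s'q; case: eqP => [//|/eqP qr]; apply: G_w; rewrite inE negb_or qr.
Qed.

Lemma tensors_generated n m (G H : Zfun1 n -> Prop) (f : Zfun n m) :
  (forall g, G g -> generated H g) ->
  generated (tensors G) f -> generated (tensors H) f.
Proof.
move=> GH; apply: generated_sub => _ [g [Gg ->]].
by apply: tensor_generated => r; apply: GH.
Qed.

(** * Polynomial functions as a span of monomials *)

Definition power n (g : Zfun1 n) : Prop := exists k, g = [ffun x => x ^+ k].

(** The support of a sum can shrink by cancellation; summing over any finite set
    containing the support makes evaluation visibly additive. *)
Lemma pevalEw (R : comPzRingType) m (D : {fset {cmonom 'I_m}})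
    (P : {mpoly R[m]}) (a : 'I_m -> R) :
  (msupp P `<=` D)%fset ->
  peval P a = \sum_(k <- D) P@_k * \prod_(i < m) a i ^+ k i.
Proof.
move=> sPD; apply: big_fset_incl => // k _ /mcoeff_outdom ->.
by rewrite mul0r.
Qed.

Lemma pevalD (R : comPzRingType) m (P Q : {mpoly R[m]}) (a : 'I_m -> R) :
  peval (P + Q) a = peval P a + peval Q a.
Proof.
rewrite (pevalEw _ (msuppD_le P Q)) (pevalEw _ (fsubsetUl _ (msupp Q))).
rewrite (pevalEw _ (fsubsetUr (msupp P) _)) -big_split /=.
by apply: eq_bigr => k _; rewrite mcoeffD mulrDl.
Qed.

Lemma peval_mono (R : comPzRingType) m (c : R) (k : {cmonom 'I_m})
    (a : 'I_m -> R) :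
  peval << c *g k >> a = c * \prod_(i < m) a i ^+ k i.
Proof. by rewrite (pevalEw _ msuppU_le) big_seq_fset1 mcoeffUU. Qed.

Lemma polynomial_funP n m (f : Zfun n m) :
  polynomial_fun f <-> generated (tensors (@power n)) f.
Proof.
split=> [[P fP]|[N [c [g [g_mono ->]]]]].
  pose mono (k : {cmonom 'I_m}) : Zfun n m :=
    tensor (fun r => [ffun x => x ^+ k r] : Zfun1 n).
  have ->: f = \sum_(k <- msupp P) P@_k *: mono k.
    apply/ffunP=> a; rewrite fP sum_ffunE; apply: eq_bigr => k _.
    rewrite !ffunE; congr (_ * _).
    by apply: eq_bigr => r _; rewrite !ffunE.
  apply: generated_sum => k _; apply/generatedZ/generated_gen.
  by exists (fun r => [ffun x => x ^+ k r]); split=> // r; exists (k r).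
elim: N c g g_mono => [|N IHN] c g g_mono.
  exists 0 => a; rewrite big_ord0 ffunE /peval msupp0.
  by rewrite big_seq_fset0.
rewrite big_ord_recl.
have [P defP] :=
  IHN (fun l => c (lift ord0 l)) _ (fun l => g_mono (lift ord0 l)).
have [h [h_pow ->]] := g_mono ord0.
have [k defh] := fin_all_exists h_pow.
pose K : {cmonom 'I_m} := CMonom [fsfun r in [fset q | q : 'I_m]%fset => k r].
exists (<< c ord0 *g K >> + P) => a; rewrite pevalD -defP !ffunE peval_mono.
congr (_ * _ + _); apply: eq_bigr => r _; rewrite defh ffunE.
by congr (_ ^+ _); rewrite [RHS]fsfunE in_imfset.
Qed.

(** The powers span a shift-invariant space, by the binomial theorem. *)
Lemma generated_shifted_power n k j :
  generated (@power n) [ffun x : Zmod n => (x - k%:R) ^+ j].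
Proof.
have ->: [ffun x : Zmod n => (x - k%:R) ^+ j] =
    \sum_(i < j.+1) ((- k%:R) ^+ i *+ 'C(j, i)) *:
      ([ffun x => x ^+ (j - i)] : Zfun1 n).
  apply/ffunP=> x; rewrite sum_ffunE ffunE exprDn; apply: eq_bigr => i _.
  by rewrite !ffunE -[RHS]/(_ *+ _ * _) mulrnAl mulrC.
apply: generated_sum => i _; apply/generatedZ/generated_gen.
by exists (j - i)%N.
Qed.

(** * Divisibility of residues *)

Section Residues.
Variables (n : nat) (n_gt0 : (0 < n)%N).

Lemma residue_nat k : residue (k%:R : Zmod n) = (k %% n)%N.
Proof.
by rewrite /residue [k%:R]Zp_mulrn /= -[in RHS](prednK n_gt0) modnMml mul1n.
Qed.

Lemma natr_residue (a : Zmod n) : (residue a)%:R = a.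
Proof.
apply: val_inj; rewrite [LHS]residue_nat modn_small //.
by rewrite -[ltnRHS](prednK n_gt0) ltn_ord.
Qed.

Lemma eq_natr_mod k l : k = l %[mod n] -> k%:R = l%:R :> Zmod n.
Proof.
by move=> kl; apply: val_inj; rewrite [LHS]residue_nat kl -residue_nat.
Qed.

(** As [d] divides [n], reduction modulo [d] is well defined on [Zmod n]; so the
    subtraction in [Zmod n] may be replaced by a congruence of naturals. *)
Lemma dvdn_residueB (d k : nat) (a : Zmod n) :
  (d %| n)%N -> (d %| residue (a - k%:R)%R)%N = (a == k %[mod d])%N.
Proof.
move=> dn; set b : Zmod n := a - k%:R.
have ba: (residue b + k)%:R = a by rewrite natrD natr_residue subrK.
have <-: residue b + k = a %[mod d].
  by rewrite -[in RHS]ba residue_nat modn_dvdm.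
by rewrite -[X in _ == X %[mod _]]add0n eqn_modDr mod0n.
Qed.

End Residues.

(** * One prime: shifted [u_{q,j}] versus powers *)

Section Prime.
Variables (n q e : nat).
Hypotheses (n_gt0 : (0 < n)%N) (q_prime : prime q) (e_gt0 : (0 < e)%N).
Hypothesis qe_n : (q ^ e %| n)%N.

Let q_n : (q %| n)%N := dvdn_trans (dvdn_exp e_gt0 (dvdnn q)) qe_n.

(** Multiplying by the cofactor [n / q^e] turns a vanishing modulo [q^e] into
    one modulo [n]; here [q^e] divides [a^j]. *)
Lemma cofactor_exp_eq0 (a : Zmod n) j :
  (q %| a)%N -> (e <= j)%N -> (n %/ q ^ e)%N%:R * a ^+ j = 0.
Proof.
move=> q_a e_j; rewrite -(natr_residue n_gt0 a) -natrX -natrM.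
apply: (eq_natr_mod n_gt0 (l := 0)); apply/eqP; rewrite mod0n.
rewrite -[X in (_ %% X)%N](divnK qe_n) -muln_modr muln_eq0; apply/orP; right.
exact: dvdn_trans (dvdn_exp2l q e_j) (dvdn_exp2r _ q_a).
Qed.

(** Euler's theorem modulo [q^e], lifted to [n] by the cofactor. *)
Lemma cofactor_exp_totient (a : Zmod n) k : ~~ (q %| a)%N ->
  (n %/ q ^ e)%N%:R * a ^+ (totient (q ^ e) * k) = (n %/ q ^ e)%N%:R.
Proof.
move=> q_a; rewrite -[in LHS](natr_residue n_gt0 a) -natrX -natrM.
apply: (eq_natr_mod n_gt0).
rewrite -[X in (_ %% X)%N](divnK qe_n) -[in RHS](muln1 (_ %/ _)%N).
rewrite -[X in _ = (_ %% X)%N](divnK qe_n) -!muln_modr expnM -modnXm.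
rewrite Euler_exp_totient ?modnXm ?exp1n //.
by rewrite coprimeXr // coprime_sym prime_coprime.
Qed.

Definition ushift j k : Zfun1 n := [ffun x => shift (@ufun n q e j) k x].

(** Modulo [q^e], the power [totient (q ^ e) * e] sends units to 1 by Euler's
    theorem and multiples of [q] to 0, because this exponent is at least [e]. *)
Lemma ufunE j (a : Zmod n) :
  ufun q e j a =
  (n %/ q ^ e)%N%:R * (a ^+ j - a ^+ (j + totient (q ^ e) * e)).
Proof.
have phi_gt0 : (0 < totient (q ^ e))%N.
  by rewrite totient_gt0 expn_gt0 prime_gt0.
rewrite /ufun mulrBr; case: ifP => [q_a|/negbT q_a].
  rewrite (cofactor_exp_eq0 (j := j + _) q_a) ?subr0 //.
  exact: leq_trans (leq_pmull _ phi_gt0) (leq_addl _ _).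
by rewrite addnC exprD mulrA (cofactor_exp_totient _ q_a) subrr.
Qed.

Lemma ushift_generated j k : generated (@power n) (ushift j k).
Proof.
pose c : Zmod n := (n %/ q ^ e)%N%:R.
have ->: ushift j k = c *: ([ffun x => (x - k%:R) ^+ j] : Zfun1 n) +
    (- c) *: ([ffun x => (x - k%:R) ^+ (j + totient (q ^ e) * e)] : Zfun1 n).
  apply/ffunP=> x; by rewrite !ffunE /shift ufunE mulrBr -mulNr.
by apply: generatedD; apply/generatedZ/generated_shifted_power.
Qed.

(** For a given [x] only [b = x %% q] contributes, and the inner sum is then
    the binomial expansion of [(b + (x - b)) ^+ k]. *)
Lemma cofactor_power_expand k :
  [ffun x : Zmod n => (n %/ q ^ e)%N%:R * x ^+ k] =
  \sum_(b < q) \sum_(j < k.+1)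
     (b%:R ^+ (k - j) *+ 'C(k, j)) *: ushift j b :> Zfun1 n.
Proof.
apply/ffunP=> x; rewrite ffunE sum_ffunE.
have q_gt0 := prime_gt0 q_prime.
rewrite (bigD1 (Ordinal (ltn_pmod x q_gt0))) //= [X in _ + X]big1 => [|b b_x].
  rewrite addr0 sum_ffunE; set b := (x %% q)%N.
  have q_y : (q %| residue (x - b%:R)%R)%N by rewrite dvdn_residueB // modn_mod.
  rewrite -{1}[x](subrK b%:R) addrC exprDn mulr_sumr; apply: eq_bigr => j _.
  rewrite !ffunE /shift /ufun q_y -[RHS]/(_ *+ _ * _).
  by rewrite [LHS]mulrnAr mulrCA [RHS]mulrnAl.
rewrite sum_ffunE big1 // => j _; rewrite !ffunE /shift /ufun dvdn_residueB //.
by rewrite [(b %% q)%N]modn_small // eq_sym ifN ?scaler0.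
Qed.

(** The expansion above may involve [ushift j b] with [e <= j], but these
    functions are zero. *)
Lemma cofactor_power_generated (H : Zfun1 n -> Prop) k :
  (forall j b, (j < e)%N -> (b < q)%N -> H (ushift j b)) ->
  generated H [ffun x : Zmod n => (n %/ q ^ e)%N%:R * x ^+ k].
Proof.
move=> H_u; rewrite cofactor_power_expand.
apply: generated_sum => b _; apply: generated_sum => j _; apply: generatedZ.
have [j_e|e_j] := ltnP j e.
  by apply/generated_gen/H_u.
suff ->: ushift j b = 0 by apply: generated0.
apply/ffunP=> x; rewrite !ffunE /shift /ufun; case: ifP => // q_y.
exact: cofactor_exp_eq0.
Qed.

End Prime.

(** * Combining the primes *)

Section Factorization.
Variables (t : nat) (p e : 'I_t -> nat) (n : nat).
Hypotheses (p_prime : forall i, prime (p i)) (e_gt0 : forall i, (0 < e i)%N).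
Hypothesis p_inj : injective p.
Hypothesis n_fact : n = (\prod_(i < t) p i ^ e i)%N.

Let n_gt0 : (0 < n)%N.
Proof. by rewrite n_fact prodn_gt0 // => i; rewrite expn_gt0 prime_gt0. Qed.

Let pe_n i : (p i ^ e i %| n)%N.
Proof. by rewrite n_fact (bigD1 i) //= dvdn_mulr. Qed.

Lemma coprime_prod I (r : seq I) (P : pred I) (F : I -> nat) a :
  (forall i, P i -> coprime a (F i)) ->
  coprime a (\prod_(i <- r | P i) F i)%N.
Proof.
move=> aF; apply: (big_ind (coprime a)) => // [|x y ax ay].
  exact: coprimen1.
by rewrite coprimeMr ax.
Qed.

Lemma cofactorE i : (n %/ p i ^ e i = \prod_(j < t | j != i) p j ^ e j)%N.
Proof.
by rewrite n_fact (bigD1 i) //= mulKn // expn_gt0 prime_gt0.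
Qed.

(** Modulo [p i] all cofactors vanish except the one of [p i], which is prime to
    [p i]; so no [p i] divides their sum. *)
Lemma coprime_sum_cofactors : coprime (\sum_(i < t) n %/ p i ^ e i)%N n.
Proof.
rewrite {2}n_fact; apply: coprime_prod => i _.
rewrite coprimeXr // coprime_sym prime_coprime // (bigD1 i) //= dvdn_addl.
  rewrite -prime_coprime // cofactorE; apply: coprime_prod => j ji.
  rewrite coprimeXr // prime_coprime // dvdn_prime2 //.
  by apply: contraNN ji => /eqP /p_inj ->.
apply: dvdn_sum => j ji; rewrite cofactorE (bigD1 i) 1?eq_sym //=.
by rewrite dvdn_mulr // dvdn_exp.
Qed.

(** The sum of the cofactors is a unit, whose inverse is a power of it by
    Euler's theorem. *)
Lemma partition_of_unity :
  exists c : Zmod n, \sum_(i < t) c * (n %/ p i ^ e i)%N%:R = 1.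
Proof.
set S := (\sum_(i < t) n %/ p i ^ e i)%N.
exists (S%:R ^+ (totient n).-1); rewrite -mulr_sumr -natr_sum -/S -exprSr.
rewrite prednK ?totient_gt0 // -natrX -[RHS]/(1%:R).
apply: (eq_natr_mod n_gt0).
exact: Euler_exp_totient coprime_sum_cofactors.
Qed.

Definition shifted (g : Zfun1 n) : Prop :=
  exists (i : 'I_t) (j k : nat),
    [/\ (j < e i)%N, (k < p i)%N & g = ushift n (p i) (e i) j k].

Lemma shifted_generated g : shifted g -> generated (@power n) g.
Proof. by move=> [i [j [k [_ _ ->]]]]; apply: ushift_generated. Qed.

Lemma power_generated g : @power n g -> generated shifted g.
Proof.
move=> [k ->]; have [c c1] := partition_of_unity.
have ->: [ffun x : Zmod n => x ^+ k] =
    \sum_(i < t) c *: ([ffun x => (n %/ p i ^ e i)%N%:R * x ^+ k] : Zfun1 n).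
  apply/ffunP=> x; rewrite ffunE sum_ffunE -[LHS]mul1r.
  rewrite -[X in X * _ = _]c1 mulr_suml.
  by apply: eq_bigr => i _; rewrite !ffunE -[LHS]mulrA.
apply: generated_sum => i _; apply: generatedZ.
by apply: cofactor_power_generated => // j b j_e b_p; exists i, j, b.
Qed.

Lemma shifted_tensorP m (f : Zfun n m) :
  shifted_tensor p e f <-> tensors shifted f.
Proof.
split=> [[i [j [k [j_e k_p ->]]]]|[g [g_sh ->]]].
  exists (fun r => ushift n (p (i r)) (e (i r)) (j r) (k r)); split.
    by move=> r; exists (i r), (j r), (k r).
  by apply: eq_tensor => r x; rewrite ffunE.
have [i g_i] := fin_all_exists g_sh.
have [j g_j] := fin_all_exists g_i.
have [k g_k] := fin_all_exists g_j.
exists i, j, k; split=> [r|r|]; try by case: (g_k r).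
by apply: eq_tensor => r x; case: (g_k r) => _ _ ->; rewrite ffunE.
Qed.

End Factorization.

Theorem proposition6p1 (t : nat) (p e : 'I_t -> nat) (n m : nat)
    (p_prime : forall i, prime (p i))
    (p_incr : forall i j : 'I_t, (i < j)%N -> (p i < p j)%N)
    (e_pos : forall i, (0 < e i)%N)
    (n_fact : n = (\prod_(i < t) p i ^ e i)%N)
    (m_pos : (0 < m)%N)
    (f : Zfun n m) :
  polynomial_fun f <-> generated (shifted_tensor p e) f.
Proof.
have p_inj : injective p.
  move=> i j pij; apply: val_inj; case: (ltngtP i j) => // /p_incr.
    by rewrite pij ltnn.
  by rewrite pij ltnn.
pose sh := @shifted t p e n; have sh_tensorP := @shifted_tensorP t p e n m.
split=> [/polynomial_funP span_f|span_f].
  have: generated (tensors sh) f.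
    by apply: tensors_generated span_f => g; apply: power_generated.
  by apply: generated_sub => w /sh_tensorP; apply: generated_gen.
apply/polynomial_funP.
have: generated (tensors sh) f.
  by apply: generated_sub span_f => w /sh_tensorP; apply: generated_gen.
by apply: tensors_generated => g; apply: shifted_generated.
Qed.
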